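(* Let $S=(s_0,\dots,s_{\ell-1})$ be an aperiodic orientable sequence of order $n$ of length $\ell$. Then $D^{-1}(S)$ consists of an o-disjoint pair of primitive, mutually complementary aperiodic orientable sequences of order $n+1$, each of length $\ell+1$.
   Context: For a finite binary sequence $S=(s_0,\dots,s_{\ell-1})$ and $0\le i\le \ell-n$, $\mathbf{s}_n(i)=(s_i,\dots,s_{i+n-1})$. The reverse of a tuple $\mathbf{u}=(u_0,\dots,u_{n-1})$ is $\mathbf{u}^R=(u_{n-1},\dots,u_0)$. $S$ is an aperiodic orientable sequence of order $n$ if the $2\ell-2n+2$ tuples $\mathbf{s}_n(i)$ and $\mathbf{s}_n(i)^R$ ($0\le i\le\ell-n$) are all distinct. Two such sequences are disjoint if they share no $n$-tuple, o-disjoint if they share no $n$-tuple in either direction (no $n$-tuple of one equals an $n$-tuple of the other or its reverse). The complement swaps $0$ and $1$ in every position; a sequence is primitive if it is disjoint from its complement. The Lempel map sends $T=(t_0,\dots,t_{\ell})$ to $D(T)=(t_0\oplus t_1,\dots,t_{\ell-1}\oplus t_\ell)$ ($\oplus$ = addition mod 2); $D^{-1}(S)$ is the set of binary sequences $T$ of length $\ell+1$ with $D(T)=S$. *)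

(* Defs.v *)
(* Binary sequences of length l are l-tuples of booleans, and (+) is addition
   mod 2. *)
From mathcomp Require Import all_boot.

Set Implicit Arguments.
Unset Strict Implicit.
Unset Printing Implicit Defensive.

(* The tuple s_n(i); it is only ever used for i + n <= l, so the default value
   of nth plays no role. *)
Definition window (n l : nat) (S : l.-tuple bool) (i : nat) : n.-tuple bool :=
  [tuple nth false S (i + j) | j < n].

(* The range is 0 <= i < l + 1 - n, that is, i + n <= l: the list is empty when
   n > l, and has l - n + 1 entries otherwise. *)
Definition windows (n l : nat) (S : l.-tuple bool) : seq (n.-tuple bool) :=
  [seq window n S i | i <- iota 0 (l.+1 - n)].

Definition reverse (n : nat) (u : n.-tuple bool) : n.-tuple bool :=
  [tuple of rev u].

Definition complement (l : nat) (S : l.-tuple bool) : l.-tuple bool :=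
  [tuple of map negb S].

Definition aperiodic_orientable (n l : nat) (S : l.-tuple bool) : Prop :=
  uniq (windows n S ++ [seq reverse u | u <- windows n S]).

Definition disjoint_seqs (n l m : nat) (S : l.-tuple bool) (T : m.-tuple bool)
    : Prop :=
  forall u v, u \in windows n S -> v \in windows n T -> u <> v.

Definition o_disjoint (n l m : nat) (S : l.-tuple bool) (T : m.-tuple bool)
    : Prop :=
  forall u v, u \in windows n S -> v \in windows n T ->
    u <> v /\ u <> reverse v.

Definition primitive (n l : nat) (S : l.-tuple bool) : Prop :=
  disjoint_seqs n S (complement S).

Definition lempel (l : nat) (T : l.+1.-tuple bool) : l.-tuple bool :=
  [tuple nth false T j (+) nth false T j.+1 | j < l].

Definition lempel_preimage (l : nat) (S : l.-tuple bool)
    : {set l.+1.-tuple bool} :=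
  [set T | lempel T == S].

(* Main.v *)
(* The Lempel map commutes with taking windows and with reversal, and
   lempel u = lempel v exactly when v is u or its complement. Hence it sends the
   list of windows of T and their reverses onto the corresponding list for
   S = lempel T, so distinctness lifts from S to T. A window of T equal to a
   window of the complement of T would lie over a single window of S, and so be
   its own complement; a window equal to the reverse of one would give the same
   coincidence in S. *)
Require Import Defs.
From mathcomp Require Import all_boot.

Lemma nth_tuple_of (T : Type) (x0 : T) (n : nat) (F : nat -> T) (k : nat) :
  k < n -> nth x0 [tuple F j | j < n] k = F k.
Proof. by move=> ltkn; rewrite (nth_mktuple _ _ (Ordinal ltkn)). Qed.

Lemma nth_window (n l : nat) (S : l.-tuple bool) (i k : nat) :
  k < n -> nth false (window n S i) k = nth false S (i + k).
Proof. exact: (@nth_tuple_of _ _ _ (fun j => nth false S (i + j))). Qed.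

Lemma nth_lempel (l : nat) (T : l.+1.-tuple bool) (k : nat) :
  k < l -> nth false (lempel T) k = nth false T k (+) nth false T k.+1.
Proof.
exact: (@nth_tuple_of _ _ _ (fun j => nth false T j (+) nth false T j.+1)).
Qed.

Lemma nth_complement (l : nat) (S : l.-tuple bool) (k : nat) :
  k < l -> nth false (complement S) k = ~~ nth false S k.
Proof. by move=> ltkl; rewrite (nth_map false) ?size_tuple. Qed.

Lemma nth_reverse (n : nat) (u : n.-tuple bool) (k : nat) :
  k < n -> nth false (reverse u) k = nth false u (n - k.+1).
Proof. by move=> ltkn; rewrite nth_rev size_tuple. Qed.

Lemma eq_tuple_nth (n : nat) (u v : n.-tuple bool) :
  (forall k, k < n -> nth false u k = nth false v k) -> u = v.
Proof.
move=> eq_uv; apply/val_inj/(@eq_from_nth _ false); first by rewrite !size_tuple.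
by move=> k; rewrite size_tuple; apply: eq_uv.
Qed.

Lemma complementK (l : nat) : involutive (@complement l).
Proof. by move=> S; apply/val_inj/mapK/negbK. Qed.

(** The length [l.+1] guarantees a bit at position 0; the empty tuple equals its own complement. *)
Lemma complement_neq (l : nat) (T : l.+1.-tuple bool) : T <> complement T.
Proof.
move=> /(congr1 (fun u : l.+1.-tuple bool => nth false u 0)).
by rewrite nth_complement //; case: nth.
Qed.

Lemma lempel_complement (l : nat) (T : l.+1.-tuple bool) :
  lempel (complement T) = lempel T.
Proof.
apply: eq_tuple_nth => k ltkl.
by rewrite !nth_lempel // !nth_complement // 1?ltnW // addbN addNb negbK.
Qed.

(** Reversal swaps the two bits of every adjacent pair, which commutativity of [(+)] absorbs. *)
Lemma lempel_reverse (l : nat) (T : l.+1.-tuple bool) :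
  lempel (reverse T) = reverse (lempel T).
Proof.
apply: eq_tuple_nth => k ltkl.
rewrite nth_lempel // !nth_reverse // 1?ltnW // nth_lempel.
  by rewrite !subSS subnSK // addbC.
by rewrite subnSK // leq_subr.
Qed.

Lemma lempel_window (n l : nat) (T : l.+1.-tuple bool) (i : nat) :
  i + n <= l -> lempel (window n.+1 T i) = window n (lempel T) i.
Proof.
move=> le_in_l; apply: eq_tuple_nth => k ltkn.
rewrite nth_lempel // !nth_window // 1?ltnW // nth_lempel ?addnS //.
by apply: leq_trans le_in_l; rewrite ltn_add2l.
Qed.

(** Sequence length and window length both drop by one, so the range of starting positions is the
    same, even when it is empty. *)
Lemma map_lempel_windows (n l : nat) (T : l.+1.-tuple bool) :
  [seq lempel u | u <- windows n.+1 T] = windows n (lempel T).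
Proof.
rewrite /windows subSS -map_comp; apply/eq_in_map => i.
by rewrite mem_iota add0n /= ltn_subRL addnC => ?; apply: lempel_window.
Qed.

Lemma windows_complement (n l : nat) (T : l.-tuple bool) :
  windows n (complement T) = [seq complement u | u <- windows n T].
Proof.
rewrite /windows -map_comp; apply/eq_in_map => i.
rewrite mem_iota add0n /= ltn_subRL ltnS => le_ni_l.
apply: eq_tuple_nth => k ltkn.
rewrite nth_complement // !nth_window // nth_complement //.
by apply: leq_trans le_ni_l; rewrite addnC ltn_add2r.
Qed.

(* A preimage is determined by its first bit. *)
Lemma lempel_fiber (l : nat) (T U : l.+1.-tuple bool) :
  lempel T = lempel U -> T = U \/ T = complement U.
Proof.
move=> eqTU.
(* The sum of the bits of [T] and [U] at position [k] does not depend on [k]; its two possible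
   values give the two cases. *)
have diff k : k < l.+1 ->
    nth false T k = (nth false T 0 (+) nth false U 0) (+) nth false U k.
  elim: k => [|k IHk] ltkl; first by rewrite addbK.
  have := nth_lempel _ U k ltkl; rewrite -eqTU nth_lempel // IHk 1?ltnW //.
  by do 5!case: nth.
case: (nth false T 0 (+) nth false U 0) diff => diff; [right | left].
  by apply: eq_tuple_nth => k ltkl; rewrite nth_complement // diff.
by apply: eq_tuple_nth => k ltkl; rewrite diff.
Qed.

Lemma lempel_surj (l : nat) (S : l.-tuple bool) :
  exists T : l.+1.-tuple bool, lempel T = S.
Proof.
(* Prefix sums mod 2 give the preimage that starts with 0: consecutive ones differ by a bit of
   [S]. *)
pose F k := foldl addb false (take k S).
exists [tuple F k | k < l.+1]; apply: eq_tuple_nth => k ltkl.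
rewrite nth_lempel // !(@nth_tuple_of _ _ _ F) // 1?ltnW // /F.
by rewrite (take_nth false) ?size_tuple // foldl_rcons addKb.
Qed.

Lemma lempel_preimage_pair (l : nat) (T : l.+1.-tuple bool) :
  lempel_preimage (lempel T) = [set T; complement T].
Proof.
apply/setP => U; rewrite !inE; apply/eqP/orP.
  by case/lempel_fiber => ->; [left | right].
by case=> /eqP ->; rewrite ?lempel_complement.
Qed.

Lemma aperiodic_orientable_lempel (n l : nat) (T : l.+1.-tuple bool) :
  aperiodic_orientable n (lempel T) -> aperiodic_orientable n.+1 T.
Proof.
(* A list is free of repetition as soon as its image is. *)
move=> uniqS; apply: (@map_uniq _ _ (@lempel n)).
have lempel_rev : @lempel n \o @reverse n.+1 =1 @reverse n \o @lempel n.
  exact: lempel_reverse.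
rewrite map_cat -(map_comp _ (@reverse n.+1)) (eq_map lempel_rev) map_comp.
by rewrite map_lempel_windows.
Qed.

(** Entries with equal images have equal indices, because the image list has no repetition. This
    recovers a window of a preimage from the window below it. *)
Lemma uniq_map_inj (T U : eqType) (f : T -> U) (s : seq T) :
  uniq [seq f x | x <- s] -> {in s &, injective f}.
Proof.
move=> uniq_fs x y xs ys eq_f.
have nth_f z : z \in s -> nth (f x) [seq f w | w <- s] (index z s) = f z.
  by move=> zs; rewrite (nth_map x) ?index_mem // nth_index.
apply: (index_inj x xs) => //.
apply/eqP; rewrite -(nth_uniq (f x) _ _ uniq_fs) ?size_map ?index_mem //.
by rewrite !nth_f // eq_f.
Qed.

Lemma o_disjoint_complement (n l : nat) (T : l.+1.-tuple bool) :
  aperiodic_orientable n (lempel T) -> o_disjoint n.+1 T (complement T).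
Proof.
rewrite /aperiodic_orientable cat_uniq => /and3P[uniqS /hasPn revS _] u v uT.
rewrite windows_complement => /mapP[w wT ->].
have inS x : x \in windows n.+1 T -> lempel x \in windows n (lempel T).
  by rewrite -map_lempel_windows; apply: map_f.
split=> eq_u; have eqD := congr1 (@lempel n) eq_u.
  (* [u] and [w] lie over the same window of [lempel T], hence coincide, and [w] would be its own
     complement. *)
  rewrite lempel_complement in eqD; rewrite -map_lempel_windows in uniqS.
  have eq_uw := @uniq_map_inj _ _ _ _ uniqS u w uT wT eqD.
  by apply: (@complement_neq _ w); rewrite -eq_u.
(* Now the window [lempel u] is the reverse of the window [lempel w], which [revS] excludes. *)
rewrite lempel_reverse lempel_complement in eqD.
by have := revS _ (map_f (@reverse n) (inS w wT)); rewrite -eqD inS.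
Qed.

Lemma o_disjoint_complement_primitive (n l : nat) (T : l.-tuple bool) :
  o_disjoint n T (complement T) -> primitive n T.
Proof. by move=> disjT u v uT vT; case: (disjT u v uT vT). Qed.

Theorem theorem6 (n l : nat) (S : l.-tuple bool) :
  aperiodic_orientable n S ->
  exists T T' : l.+1.-tuple bool,
    [/\ lempel_preimage S = [set T; T'] /\ T <> T',
        T' = complement T /\ T = complement T',
        o_disjoint n.+1 T T',
        primitive n.+1 T /\ primitive n.+1 T' &
        aperiodic_orientable n.+1 T /\ aperiodic_orientable n.+1 T'].
Proof.
have [T <-] := lempel_surj _ S => aoS.
(* [complement T] lies over the same sequence, so the results on [T] apply to it as well. *)
have aoS' : aperiodic_orientable n (lempel (complement T)).
  by rewrite lempel_complement.
exists T, (complement T); split.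
- by split; [apply: lempel_preimage_pair | apply: complement_neq].
- by rewrite complementK.
- exact: o_disjoint_complement.
- by split; apply/o_disjoint_complement_primitive/o_disjoint_complement.
- by split; apply: aperiodic_orientable_lempel.
Qed.
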